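(* Let $d\ge 1$, $M\in\mathbb{N}$ with $M\ge 2$, $p\in(0,1]$, and let $F$ be a fractal percolation on $[0,1]^d$ with parameters $M$ and $p$, with construction steps $F_n$. Then, for each $n\in\mathbb{N}$, $\mathbb{E}V_d(F_n)=p^n$ and $$\mathrm{Var}(V_d(F_n))=\begin{cases}\dfrac{1-p}{M^dp-1}\left(p^{2n}-\left(\dfrac{p}{M^d}\right)^n\right), & p\neq M^{-d},\\[2mm] (1-p)\cdot n\cdot p^{2n}, & p=M^{-d}.\end{cases}$$
   Context: Fractal percolation: Let $J=[0,1]^d$, $\Sigma=\{1,\ldots,M^d\}$, let $J_1,\ldots,J_{M^d}$ be the $M^d$ closed subcubes of side length $1/M$ into which $J$ is divided, and let $\varphi_j$ be the homothetic (rotation- and reflection-free) similarity mapping $J$ onto $J_j$. For $\sigma=\sigma_1\ldots\sigma_n\in\Sigma^n$ let $J_\sigma=\varphi_{\sigma_1}\circ\cdots\circ\varphi_{\sigma_n}(J)$, and for $m\le n$ let $\sigma|m=\sigma_1\ldots\sigma_m$. Let $\{Y_\sigma:\sigma\in\bigcup_{n\ge1}\Sigma^n\}$ be i.i.d. Bernoulli variables with parameter $p$. Put $F_0=J$ and, for $n\ge1$, let $F_n$ be the union of all $J_\sigma$, $\sigma\in\Sigma^n$, with $Y_{\sigma|1}=\cdots=Y_{\sigma|n}=1$. The fractal percolation is $F=\bigcap_n F_n$. $V_d$ is the $d$-dimensional volume (Lebesgue measure). *)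

(* Defs.v *)
From HB Require Import structures.
From mathcomp Require Import all_boot all_order all_algebra.
From mathcomp Require Import all_classical all_reals all_analysis.

Set Implicit Arguments.
Unset Strict Implicit.
Unset Printing Implicit Defensive.
Import Order.TTheory GRing.Theory Num.Theory.
Local Open Scope classical_set_scope.
Local Open Scope ring_scope.

(* cons_product m is the product of the Lebesgue measure on R with m, carried
   over to tuples along R * R^n ~ R^(n+1). *)
Section cons_product.
Context {R : realType} (n : nat).

Definition cons_pair (x : measurableTypeR R * n.-tuple R) : n.+1.-tuple R :=
  [the n.+1.-tuple R of x.1 :: x.2].

Let measurable_cons_pair : measurable_fun setT cons_pair.
Proof.
apply: measurable_cons; last exact: measurable_snd.
exact: (@measurable_fst _ _ (measurableTypeR R) (n.-tuple R)).
Qed.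

HB.instance Definition _ :=
  isMeasurableFun.Build _ _ _ _ cons_pair measurable_cons_pair.

Variable m : {sigma_finite_measure set (n.-tuple R) -> \bar R}.

Definition cons_product : set (n.+1.-tuple R) -> \bar R :=
  pushforward (@lebesgue_measure R \x m)%E cons_pair.

Let cons_product0 : cons_product set0 = 0%E.
Proof. exact: measure0. Qed.

Let cons_product_ge0 A : (0 <= cons_product A)%E.
Proof. exact: measure_ge0. Qed.

Let cons_product_sigma_additive : semi_sigma_additive cons_product.
Proof. exact: measure_semi_sigma_additive. Qed.

HB.instance Definition _ := isMeasure.Build _ _ _ cons_product
  cons_product0 cons_product_ge0 cons_product_sigma_additive.

Let uncons (x : n.+1.-tuple R) : measurableTypeR R * n.-tuple R :=
  (thead x, [tuple of behead x]).

Let uncons_measurable : measurable_fun setT uncons.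
Proof.
apply: measurable_fun_pair; last exact: measurable_behead.
exact: measurable_tnth.
Qed.

Let lebesgue_prod_sigma_finite : sigma_finite setT (@lebesgue_measure R \x m)%E.
Proof.
have /sigma_finiteP[F [TF ndF Foo]] := sigma_finiteT (@lebesgue_measure R).
have /sigma_finiteP[G [TG ndG Goo]] := sigma_finiteT m.
exists (fun k => F k `*` G k).
  rewrite -setXTT TF TG predeqE => -[x y]; split.
    move=> [/= [k _ Fkx] [l _ Gly]]; exists (maxn k l) => //; split.
    - by move: x Fkx; exact/subsetPset/ndF/leq_maxl.
    - by move: y Gly; exact/subsetPset/ndG/leq_maxr.
  by move=> [k _ []/= ? ?]; split; exists k.
move=> k; have [? ?] := Foo k; have [? ?] := Goo k.
split; first exact: measurableX.
by rewrite product_measure1E// lte_mul_pinfty// ge0_fin_numE.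
Qed.

Let cons_product_sigma_finite : sigma_finite setT cons_product.
Proof.
have [F FT mF] := lebesgue_prod_sigma_finite.
exists (fun k => uncons @^-1` F k).
  by rewrite -preimage_bigcup -FT preimage_setT.
move=> k; have [mFk Fk] := mF k; split.
  by rewrite -[X in measurable X]setTI; exact: uncons_measurable.
rewrite /cons_product /pushforward -comp_preimage.
rewrite (_ : uncons \o cons_pair = id)// funeqE => -[x t] /=.
by rewrite /uncons /cons_pair/= theadE; congr pair; exact/val_inj.
Qed.

HB.instance Definition _ := @Measure_isSigmaFinite.Build _ _ _
  cons_product cons_product_sigma_finite.

End cons_product.

(* Lebesgue measure on R^d, as the d-fold product of the one-dimensional one;
   see volume_box for its values on boxes. *)
Fixpoint volume {R : realType} (d : nat) :
    {sigma_finite_measure set (d.-tuple R) -> \bar R} :=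
  match d with
  | 0 => @dirac _ (0.-tuple R) [tuple] R
  | d'.+1 => cons_product (volume d')
  end.

Section volume_box.
Context {R : realType}.

Let box (d : nat) (a b : d.-tuple R) : set (d.-tuple R) :=
  [set x | forall i, tnth x i \in `[tnth a i, tnth b i]].

Lemma measurable_box (d : nat) (a b : d.-tuple R) : measurable (box a b).
Proof.
rewrite (_ : box a b = \bigcap_(i in [set: 'I_d])
    ((fun x : d.-tuple R => tnth x i) @^-1` `[tnth a i, tnth b i])).
  apply: fin_bigcap_measurable => // i _.
  by rewrite -[X in measurable X]setTI; apply: measurable_tnth.
by apply/seteqP; split=> [x bx i _|x bx i]; [exact: bx|exact: bx].
Qed.

Lemma volume_box (d : nat) (a b : d.-tuple R) :
  (forall i, tnth a i <= tnth b i) ->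
  volume d [set x | forall i, tnth x i \in `[tnth a i, tnth b i]] =
  (\prod_(i < d) (tnth b i - tnth a i))%:E.
Proof.
elim: d a b => [|d IH] a b ab.
  rewrite big_ord0 /= diracE mem_set// => -[].
  by case.
rewrite /= /cons_product /pushforward.
pose a' := [tuple of behead a]; pose b' := [tuple of behead b].
have aE i : tnth a (lift ord0 i) = tnth a' i.
  by rewrite [in LHS](tuple_eta a) tnthS.
have bE i : tnth b (lift ord0 i) = tnth b' i.
  by rewrite [in LHS](tuple_eta b) tnthS.
rewrite (_ : _ @^-1` _ = `[thead a, thead b] `*` box a' b').
  rewrite product_measure1E//; last exact: measurable_box.
  have lab : lebesgue_measure (`[thead a, thead b]%classic : set R) =
      (thead b - thead a)%:E.
    rewrite lebesgue_measure_itv/= lte_fin.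
    have := ab ord0; rewrite le_eqVlt => /predU1P[abE|->//].
    by rewrite /thead abE ltxx subrr.
  rewrite big_ord_recl EFinM; congr (_ * _)%E; first exact: lab.
  rewrite IH => [|i]; last by rewrite -aE -bE.
  by congr EFin; apply: eq_bigr => i _; rewrite aE bE.
apply/seteqP; split => [[x t]/= xt|[x t]/= [xab tab] i].
  split => /= [|i]; first by have := xt ord0.
  by have := xt (lift ord0 i); rewrite aE bE tnthS.
by have [j ->|->//] := unliftP ord0 i; rewrite aE bE tnthS; exact: tab.
Qed.

End volume_box.

(* Mutual independence of the subfamily (X i), i in D. *)
Definition mutually_independent d d' (T : measurableType d)
    (T' : measurableType d') (R : realType) (P : probability T R)
    (I : choiceType) (D : set I) (X : I -> {RV P >-> T'}) : Prop :=
  forall (s : seq I) (A : I -> set T'), uniq s -> [set` s] `<=` D ->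
    (forall i, i \in s -> measurable (A i)) ->
    P (\bigcap_(i in [set` s]) (X i @^-1` A i)) =
    (\prod_(i <- s) P (X i @^-1` A i))%E.

Section fractal_percolation.
Context {R : realType} {d M : nat}.

Definition unit_cube : set (d.-tuple R) :=
  [set x | forall i, tnth x i \in `[0, 1]].

(* The homothety x |-> (x + c) / M, mapping the unit cube onto the subcube of
   side 1 / M in position c of the M-adic grid. *)
Definition similarity (c : d.-tuple 'I_M) (x : d.-tuple R) : d.-tuple R :=
  [tuple (tnth x i + (tnth c i)%:R) / M%:R | i < d].

Lemma similarity_unit_cube (c : d.-tuple 'I_M) : (0 < M)%N ->
  similarity c @` unit_cube =
  [set x | forall i, tnth x i \in
    `[(tnth c i)%:R / M%:R, (tnth c i).+1%:R / M%:R]].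
Proof.
move=> M0; have M0' : 0 < M%:R :> R by rewrite ltr0n.
apply/seteqP; split=> [_ [x xJ <-] i|x xc].
  have := xJ i; rewrite !in_itv/= tnth_mktuple => /andP[x0 x1].
  by rewrite !ler_pM2r ?invr_gt0// lerDr x0 -natr1 addrC lerD2l.
exists [tuple tnth x i * M%:R - (tnth c i)%:R | i < d].
  move=> i; have := xc i; rewrite !in_itv/= tnth_mktuple => /andP[x0 x1].
  by rewrite subr_ge0 -ler_pdivrMr// x0 lerBlDr nat1r -ler_pdivlMr.
apply: eq_from_tnth => i; rewrite !tnth_mktuple subrK mulfK//.
by rewrite gt_eqF.
Qed.

(* [cell] enumerates the M^d subcubes: the j-th one has position [cell j]. *)
Variable cell : 'I_(M ^ d)%N -> d.-tuple 'I_M.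

Definition cylinder_cube (s : seq 'I_(M ^ d)%N) : set (d.-tuple R) :=
  foldr (fun j f => similarity (cell j) \o f) id s @` unit_cube.

Context {disp : measure_display} {T : measurableType disp}
  {P : probability T R} (Y : seq 'I_(M ^ d)%N -> {RV P >-> bool}).

Definition percolation_step (n : nat) (w : T) : set (d.-tuple R) :=
  if n is 0 then unit_cube else
  \bigcup_(s in [set s : n.-tuple 'I_(M ^ d)%N |
      forall m, (1 <= m <= n)%N -> Y (take m s) w = true]) cylinder_cube s.

Definition fractal_percolation (w : T) : set (d.-tuple R) :=
  \bigcap_n percolation_step n w.

(* percolation_step n w is a finite union of cubes, so [fine] is harmless. *)
Definition step_volume (n : nat) (w : T) : R :=
  fine (volume d (percolation_step n w)).

End fractal_percolation.

(* Main.v *)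
(* The closed cubes of generation n have total volume 1 and cover the unit cube,
   so any subfamily of them behaves for the volume as if it were disjoint, and
   V_d(F_n) = N^-n * sum_s 1_(A_s), where N = M^d, s ranges over the words of
   length n, and A_s is the event that Y u = 1 for every nonempty prefix u of s.
   By independence P(A_s) = p^n and P(A_s and A_t) = p^k(s,t), where k(s,t) is
   the number of distinct nonempty prefixes of s or t. Splitting off the first
   letters of s and t gives for S_n = sum_(s,t) p^k(s,t) the recursion
   S_(n+1) = N p S_n + N (N - 1) N^(2n) p^(2n+2), and Var V_d(F_n) is
   N^-2n S_n - p^2n. *)
Require Import Defs.
From HB Require Import structures.
From mathcomp Require Import all_boot all_order all_algebra.
From mathcomp Require Import zify ring lra.
From mathcomp Require Import all_classical all_reals all_analysis.

Import Order.TTheory GRing.Theory Num.Theory.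
Local Open Scope classical_set_scope.
Local Open Scope ring_scope.

(** * Nonempty prefixes of words, and how many two words have jointly *)

(** Lengths start at 1 because the root carries no variable; the full word [s] is included. *)
Definition prefixes {I : Type} (s : seq I) : seq (seq I) :=
  [seq take m s | m <- iota 1 (size s)].
Arguments prefixes : simpl never.

Lemma prefixes_cons {I : Type} (x : I) (s : seq I) :
  prefixes (x :: s) = [:: x] :: map (cons x) (prefixes s).
Proof.
rewrite /prefixes /= take0; congr cons.
rewrite (iotaDl 1 1) -!map_comp; exact: eq_map.
Qed.

Lemma size_prefixes {I : Type} (s : seq I) : size (prefixes s) = size s.
Proof. by rewrite size_map size_iota. Qed.

Section joint_prefixes.
Context {I : eqType}.
Implicit Types (x y : I) (s t : seq I).

Lemma mem_prefixes_behead x s u :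
  u \in prefixes (x :: s) -> exists v, u = x :: v.
Proof.
rewrite prefixes_cons inE => /predU1P[->|/mapP[v _ ->]]; first by exists [::].
by exists v.
Qed.

Lemma nil_notin_prefixes s : [::] \notin prefixes s.
Proof.
by case: s => // x s; apply/negP => /mem_prefixes_behead[].
Qed.

Lemma uniq_prefixes s : uniq (prefixes s).
Proof.
elim: s => // x s IH; rewrite prefixes_cons /= map_inj_uniq => [|u v []//].
rewrite IH andbT; apply/negP => /mapP[u us [u0]].
by move: (nil_notin_prefixes s); rewrite u0 us.
Qed.

Definition nb_joint_prefixes s t := size (undup (prefixes s ++ prefixes t)).

(** The shared letter gives the single prefix [[:: x]], counted once; all longer prefixes arise by
    putting [x] in front of a prefix of [s] or [t]. Two duplicate-free lists with the same elements
    have the same size. *)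
Lemma nb_joint_prefixes_cons x s t :
  nb_joint_prefixes (x :: s) (x :: t) = (nb_joint_prefixes s t).+1.
Proof.
rewrite /nb_joint_prefixes -[in RHS](size_map (cons x)).
rewrite -[RHS]/(size ([:: x] :: map (cons x) (undup (prefixes s ++ prefixes t)))).
apply/eqP; rewrite -uniq_size_uniq ?undup_uniq//.
- rewrite cons_uniq map_inj_uniq ?undup_uniq ?andbT => [|u v []//].
  apply/negP => /mapP[u + [u0]]; rewrite -u0 mem_undup mem_cat.
  by rewrite !(negbTE (nil_notin_prefixes _)).
- move=> u; rewrite mem_undup !prefixes_cons mem_cat !inE.
  have -> : (u \in map (cons x) (undup (prefixes s ++ prefixes t))) =
      (u \in map (cons x) (prefixes s)) || (u \in map (cons x) (prefixes t)).
    rewrite -mem_cat -map_cat; apply/mapP/mapP => -[v vst ->]; exists v => //.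
      by rewrite mem_undup in vst.
    by rewrite mem_undup.
  by rewrite orbACA orbb.
Qed.

(** Every nonempty prefix begins with the first letter of its word, so the two lists are
    disjoint. *)
Lemma nb_joint_prefixes_cons_neq x y s t : x != y ->
  nb_joint_prefixes (x :: s) (y :: t) = (size s).+1 + (size t).+1.
Proof.
move=> xy; rewrite /nb_joint_prefixes undup_id ?size_cat ?size_prefixes//.
rewrite cat_uniq !uniq_prefixes andbT; apply/hasPn => u.
move=> /mem_prefixes_behead[v ->]; apply/negP => /mem_prefixes_behead[w [yx _]].
by rewrite yx eqxx in xy.
Qed.

End joint_prefixes.

Lemma big_tuple_cons {R : Type} {idx : R} (op : Monoid.com_law idx)
    {I : finType} {n : nat} (F : seq I -> R) :
  \big[op/idx]_(t : n.+1.-tuple I) F t =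
  \big[op/idx]_(x : I) \big[op/idx]_(t : n.-tuple I) F (x :: t).
Proof.
rewrite pair_big/= (reindex (fun xt : I * n.-tuple I => [tuple of xt.1 :: xt.2])).
  by [].
exists (fun t => (thead t, [tuple of behead t])) => [[x t]|t] _ /=.
  by congr pair; exact/val_inj.
by rewrite [RHS]tuple_eta; exact/val_inj.
Qed.

(** * The second-moment recursion and its solution *)

Section moment_recursion.
Context {R : realFieldType} {I : finType}.
Local Notation N := (#|I|%:R : R).

Definition joint_moment (p : R) (n : nat) : R :=
  \sum_(s : n.-tuple I) \sum_(t : n.-tuple I) p ^+ nb_joint_prefixes s t.

Lemma joint_momentS p n : joint_moment p n.+1 =
  N * p * joint_moment p n + N * (N - 1) * N ^+ (2 * n) * p ^+ (2 * n + 2).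
Proof.
rewrite {1}/joint_moment.
rewrite (big_tuple_cons _ (fun s => \sum_(t : n.+1.-tuple I) p ^+ nb_joint_prefixes s t)).
have rowE (x : I) : \sum_(s : n.-tuple I) \sum_(t : n.+1.-tuple I)
    p ^+ nb_joint_prefixes (x :: s) t =
    p * joint_moment p n + (N - 1) * N ^+ (2 * n) * p ^+ (2 * n + 2).
  under eq_bigr do rewrite
    (big_tuple_cons _ (fun t => p ^+ nb_joint_prefixes (x :: _) t)).
  (* With the first letter of [t] outermost, the letter [x] gives [p * joint_moment p n]; each of
     the N - 1 others gives a constant term over N^(2n) pairs of tails. *)
  rewrite exchange_big (bigD1 x)//=; congr (_ + _).
    rewrite /joint_moment mulr_sumr; apply: eq_bigr => s _.
    rewrite mulr_sumr; apply: eq_bigr => t _.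
    by rewrite nb_joint_prefixes_cons exprS.
  rewrite (eq_bigr (fun=> N ^+ (2 * n) * p ^+ (2 * n + 2))).
    rewrite sumr_const cardC1 -[LHS]mulr_natl -subn1 natrB ?mulrA//.
    by apply/card_gt0P; exists x.
  move=> y yx.
  rewrite (eq_bigr (fun=> N ^+ n * p ^+ (2 * n + 2))) => [|s _].
    by rewrite sumr_const card_tuple -[LHS]mulr_natl natrX mulrA -exprD mul2n addnn.
  rewrite (eq_bigr (fun=> p ^+ (2 * n + 2))) => [|t _].
    by rewrite sumr_const card_tuple -[LHS]mulr_natl natrX.
  rewrite nb_joint_prefixes_cons_neq 1?eq_sym//.
  by rewrite !size_tuple; congr (_ ^+ _); lia.
by rewrite (eq_bigr _ (fun x _ => rowE x)) sumr_const -[LHS]mulr_natl; ring.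
Qed.

(** The variance formula of the theorem, with the number of letters N in place of M^d. *)
Definition volume_variance (p : R) (n : nat) : R :=
  if p != N^-1
  then (1 - p) / (N * p - 1) * (p ^+ (2 * n) - (p / N) ^+ n)
  else (1 - p) * n%:R * p ^+ (2 * n).

Lemma joint_momentE p n : N != 0 ->
  N ^- n * N ^- n * joint_moment p n - p ^+ n * p ^+ n = volume_variance p n.
Proof.
move=> N0; elim: n => [|n IH].
  (* For n = 0 the only pair is that of the empty words, so the moment is 1; both cases of the
     formula vanish. *)
  rewrite /joint_moment /volume_variance !expr0 subrr !mulr0 mul0r if_same.
  rewrite (eq_bigr (fun=> 1)) => [|s _].
    by rewrite sumr_const card_tuple expn0 !invr1 !mul1r subrr.
  rewrite (eq_bigr (fun=> 1)) ?sumr_const ?card_tuple// => t _.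
  by rewrite (tuple0 s) (tuple0 t).
(* In terms of the variance the recursion reads v(n+1) = (p/N) v(n) + ((p - p^2)/N) p^(2n). *)
have -> : N ^- n.+1 * N ^- n.+1 * joint_moment p n.+1 - p ^+ n.+1 * p ^+ n.+1 =
    p / N * (N ^- n * N ^- n * joint_moment p n - p ^+ n * p ^+ n) +
    (p - p ^+ 2) / N * (p ^+ n * p ^+ n).
  by rewrite joint_momentS mul2n -addnn !exprD !exprS; field; rewrite N0 expf_neq0.
rewrite IH /volume_variance !mul2n -!addnn !exprD !exprS expr_div_n.
(* At p = 1/N the ratio p/N equals p^2, so the forcing term resonates with the homogeneous solution;
   this produces the factor n. *)
case: eqVneq => [->|pN] /=; first by rewrite -natr1; field.
have Np1 : N * p - 1 != 0.
  apply: contra_neq pN => /eqP; rewrite subr_eq0 => /eqP Np.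
  by rewrite -[LHS](mulKf N0) Np mulr1.
by field; rewrite Np1 N0 expf_neq0.
Qed.

End moment_recursion.

(** * Expectation and variance of weighted sums of indicators *)

Section indicator_sums.
Context {disp : measure_display} {T : measurableType disp} {R : realType}.
Variable P : probability T R.

Lemma integrable_sum_indic {I : finType} (c : I -> R) (A : I -> set T) :
  (forall i, measurable (A i)) ->
  P.-integrable setT (EFin \o (fun w => \sum_i c i * \1_(A i) w)).
Proof.
move=> mA; rewrite (_ : _ \o _ = fun w => (\sum_i (c i)%:E * (\1_(A i) w)%:E)%E).
  by apply: integrable_sum => // i _; apply: integrableZl => //; exact: integrable_indic.
by apply/funext => w; rewrite /= -sumEFin; apply: eq_bigr => i _; rewrite EFinM.
Qed.

Lemma expectation_sum_indic {I : finType} (c : I -> R) (A : I -> set T) :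
  (forall i, measurable (A i)) ->
  ('E_P[fun w => (\sum_i c i * \1_(A i) w)%R] = \sum_i (c i)%:E * P (A i))%E.
Proof.
move=> mA; rewrite unlock.
under eq_integral do rewrite -sumEFin.
rewrite integral_sum => [|//|i]; last first.
  under eq_fun do rewrite EFinM.
  by apply: integrableZl => //; exact: integrable_indic.
apply: eq_bigr => i _; under eq_integral do rewrite EFinM.
by rewrite integralZl ?integral_indic ?setIT//; exact: integrable_indic.
Qed.

Lemma variance_sum_indic {I : finType} (c : I -> R) (A : I -> set T) :
  (forall i, measurable (A i)) ->
  ('V_P[fun w => (\sum_i c i * \1_(A i) w)%R] =
   \sum_i \sum_j (c i * c j)%:E * P (A i `&` A j) -
   (\sum_i (c i)%:E * P (A i)) * (\sum_i (c i)%:E * P (A i)))%E.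
Proof.
move=> mA; set X := fun w => _.
(* The square is again a weighted sum of indicators, now indexed by pairs, so the expectation
   formula applies to it too. *)
have XX : X * X = fun w => \sum_ij c ij.1 * c ij.2 * \1_(A ij.1 `&` A ij.2) w.
  apply/funext => w; rewrite /X [LHS]mulr_suml.
  rewrite -(pair_bigA _ (fun i j => c i * c j * \1_(A i `&` A j) w)).
  apply: eq_bigr => i _; rewrite mulr_sumr; apply: eq_bigr => j _.
  by rewrite indicI /= mulrACA.
have mAA (ij : I * I) : measurable (A ij.1 `&` A ij.2) by exact: measurableI.
rewrite /variance covarianceE; last 3 first.
- exact/Lfun1_integrable/integrable_sum_indic.
- exact/Lfun1_integrable/integrable_sum_indic.
- by rewrite XX; exact/Lfun1_integrable/integrable_sum_indic.
rewrite !expectation_sum_indic// XX.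
rewrite (expectation_sum_indic (fun ij : I * I => c ij.1 * c ij.2))//.
by rewrite -(pair_bigA _ (fun i j => (c i * c j)%:E * P (A i `&` A j))%E).
Qed.

End indicator_sums.

(** * Joint success probabilities in an independent Bernoulli family *)

Section bernoulli_field.
Context {R : realType} {p : R} {disp : measure_display} {T : measurableType disp}.
Context {P : probability T R} {I : choiceType} {D : set I}.
Context {Y : I -> {RV P >-> bool}}.
Hypothesis p01 : 0 <= p <= 1.
Hypothesis Y_bernoulli : forall i, D i -> distribution P (Y i) =1 bernoulli_prob p.
Hypothesis Y_indep : mutually_independent D Y.

(** Independence is stated for duplicate-free lists; passing to [undup s] keeps the event and counts
    each variable once. *)
Lemma prob_all_true (s : seq I) : [set` s] `<=` D ->
  P (\bigcap_(i in [set` s]) Y i @^-1` [set true]) = (p ^+ size (undup s))%:E.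
Proof.
move=> sD; have -> : [set` s] = [set` undup s].
  by apply/seteqP; split=> i /=; rewrite mem_undup.
rewrite (Y_indep (undup s) (fun=> [set true])) ?undup_uniq//.
- rewrite (eq_big_seq (fun=> p%:E)) => [|i]; last first.
    rewrite mem_undup => /sD /Y_bernoulli /(_ [set true]).
    rewrite /distribution /pushforward => ->.
    rewrite bernoulli_probE// !diracE mem_set// memNset//=.
    by rewrite mule0 mule1 adde0.
  by rewrite prodEFin big_const_seq count_predT -Monoid.iteropE.
- by move=> i /=; rewrite mem_undup => /sD.
Qed.

End bernoulli_field.

(** * Volumes of cylinder cubes and of their unions *)

Lemma le_measure_bigsetU {d} {T : ringOfSetsType d} {R : realFieldType}
    (mu : {content set T -> \bar R}) {I : finType} (a : pred I) (F : I -> set T) :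
  (forall i, measurable (F i)) ->
  (mu (\big[setU/set0]_(i | a i) F i) <= \sum_(i | a i) mu (F i))%E.
Proof.
move=> mF.
(* Measurability of the partial unions is carried along, since subadditivity for two sets requires
   it. *)
suff [] : measurable (\big[setU/set0]_(i | a i) F i) /\
  (mu (\big[setU/set0]_(i | a i) F i) <= \sum_(i | a i) mu (F i))%E by [].
elim/big_rec2 : _ => [|i x y _ [my yx]]; first by rewrite measure0.
split; first exact: measurableU.
by rewrite (le_trans (measureU2 _ _ _))// leeD2l.
Qed.

Section cylinders.
Context {R : realType} {d M : nat}.
Hypothesis M_gt0 : (0 < M)%N.
Variable cell : 'I_(M ^ d)%N -> d.-tuple 'I_M.
Hypothesis cell_bij : bijective cell.

Local Notation cyl := (@cylinder_cube R d M cell).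
Local Notation J := (@unit_cube R d).

Lemma cylinder_cube_cons j s :
  cyl (j :: s) = similarity (cell j) @` cyl s.
Proof. by rewrite /cylinder_cube /= image_comp. Qed.

(** Each homothety sends lower corner to lower corner and divides the side by M, so only the corner
    depends on the letters. *)
Lemma cylinder_cube_box s : exists a : d.-tuple R,
  cyl s = [set x | forall i, tnth x i \in
    `[tnth a i, tnth [tuple tnth a k + M%:R ^- size s | k < d] i]].
Proof.
have M0 : 0 < M%:R :> R by rewrite ltr0n.
elim: s => [|j s [a IH]].
  exists [tuple 0 | i < d]; rewrite /cylinder_cube /= image_id.
  by apply/seteqP; split=> x xJ i; have := xJ i; rewrite !tnth_mktuple add0r expr0 invr1.
exists (similarity (cell j) a).
rewrite cylinder_cube_cons IH; apply/seteqP; split=> [_ [x xa <-] i|x xa].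
  have := xa i; rewrite !in_itv/= !tnth_mktuple exprS invfM.
  set y := tnth x i; set b := tnth a i; set l := M%:R ^- size s; set c := _%:R.
  have -> : (b + c) / M%:R + M%:R^-1 * l = (b + l + c) / M%:R by ring.
  by rewrite !ler_pM2r ?invr_gt0// !lerD2r.
(* The preimage of [x] under the homothety. *)
exists [tuple tnth x i * M%:R - (tnth (cell j) i)%:R | i < d].
  move=> i; have := xa i; rewrite !in_itv/= !tnth_mktuple exprS invfM.
  set y := tnth x i; set b := tnth a i; set l := M%:R ^- size s; set c := _%:R.
  have -> : (b + c) / M%:R + M%:R^-1 * l = (b + l + c) / M%:R by ring.
  by rewrite ler_pdivrMr// ler_pdivlMr// lerBrDr lerBlDr.
by apply: eq_from_tnth => i; rewrite !tnth_mktuple subrK mulfK// gt_eqF.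
Qed.

Lemma measurable_cylinder_cube s : measurable (cyl s).
Proof. by have [a ->] := cylinder_cube_box s; exact: measurable_box. Qed.

Lemma volume_cylinder_cube s : volume d (cyl s) = ((M ^ d)%:R ^- size s)%:E.
Proof.
have [a ->] := cylinder_cube_box s; rewrite volume_box => [|i]; last first.
  by rewrite tnth_mktuple lerDl invr_ge0 exprn_ge0.
rewrite (eq_bigr (fun=> M%:R ^- size s)) => [|i _].
  by rewrite prodr_const card_ord natrX exprVn -!exprM mulnC.
by rewrite tnth_mktuple addrC addKr.
Qed.

Lemma similarity_cover (x : d.-tuple R) : J x ->
  exists c : d.-tuple 'I_M, (similarity c @` J) x.
Proof.
(* The grid index is the integer part of M x_i; the cap M - 1 handles x_i = 1, where the integer
   part would be M. *)
move=> xJ; pose k i := minn (Num.truncn (tnth x i * M%:R)) M.-1.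
have kM i : (k i < M)%N by rewrite (leq_ltn_trans (geq_minr _ _))// prednK.
exists [tuple Ordinal (kM i) | i < d]; rewrite similarity_unit_cube// => i.
have := xJ i; rewrite !in_itv/= tnth_mktuple/= => /andP[x0 x1].
have M0 : 0 < M%:R :> R by rewrite ltr0n.
rewrite ler_pdivrMr// ler_pdivlMr//.
have xM0 : 0 <= tnth x i * M%:R by rewrite mulr_ge0.
have /andP[lx xu] := truncn_itv xM0.
apply/andP; split.
  by apply: le_trans lx; rewrite ler_nat geq_minl.
(* The index plus one is the minimum of the integer part plus one and M; the bound by M comes from
   x_i <= 1. *)
rewrite /k -minnSS prednK// natr_min le_min (ltW xu) /=.
by rewrite -[leRHS]mul1r ler_pM2r.
Qed.

(** A point of [J] lies in some first-level cube; its preimage there is again in [J], and induction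
    supplies the remaining letters. *)
Lemma unit_cube_cover n : J `<=` \big[setU/set0]_(s : n.-tuple 'I_(M ^ d)) cyl s.
Proof.
have [cell' _ cellK] := cell_bij.
rewrite -bigcup_pred; elim: n => [|n IH] x xJ.
  by exists [tuple] => //; exists x.
have [c [y /IH[s _ ys] yx]] := similarity_cover _ xJ.
exists [tuple of cell' c :: s] => //.
by rewrite cylinder_cube_cons cellK; exists y.
Qed.

(* The volumes of the union over [a] and of the union over its complement add up
   to at least 1, the sum of all the volumes, so both subadditivity bounds are
   equalities. *)
Lemma volume_bigsetU_cylinder_cube n (a : pred (n.-tuple 'I_(M ^ d))) :
  volume d (\big[setU/set0]_(s | a s) cyl s) =
  (\sum_(s | a s) (M ^ d)%:R ^- n)%:E.
Proof.
set N : R := (M ^ d)%:R.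
have N0 : N != 0 by rewrite pnatr_eq0 -lt0n expn_gt0 M_gt0.
pose U (b : pred (n.-tuple 'I_(M ^ d))) := \big[setU/set0]_(s | b s) cyl s.
have mU b : measurable (U b).
  by apply: bigsetU_measurable => s _; exact: measurable_cylinder_cube.
have leU b : (volume d (U b) <= (\sum_(s | b s) N ^- n)%:E)%E.
  rewrite (le_trans (le_measure_bigsetU _ _ _ _))//.
    by move=> s; exact: measurable_cylinder_cube.
  rewrite -sumEFin; apply: lee_sum => s _.
  by have := lexx (volume d (cyl s)); rewrite {2}volume_cylinder_cube size_tuple.
have fU b : volume d (U b) \is a fin_num.
  by rewrite ge0_fin_numE// (le_lt_trans (leU b))// ltry.
have J1 : volume d J = 1%E.
  by have := volume_cylinder_cube [::]; rewrite /cylinder_cube image_id expr0 invr1.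
have mJ : measurable J.
  by have := measurable_cylinder_cube [::]; rewrite /cylinder_cube image_id.
have tot : \sum_(s | a s) N ^- n + \sum_(s | ~~ a s) N ^- n = 1.
  transitivity (\sum_(s : n.-tuple 'I_(M ^ d)) N ^- n).
    by rewrite [RHS](bigID a).
  rewrite sumr_const card_tuple card_ord -[LHS]mulr_natl natrX divff//.
  exact: expf_neq0.
apply/eqP; rewrite eq_le leU/=.
have : (1 <= volume d (U a) + volume d (U (predC a)))%E.
  rewrite -J1 (le_trans _ (measureU2 _ _ _))// le_measure ?inE//.
    exact: measurableU.
  by apply: subset_trans (unit_cube_cover n) _; rewrite (bigID a).
move: (leU (predC a)); rewrite /U -(fineK (fU a)) -(fineK (fU (predC a))) -EFinD !lee_fin.
move: tot; rewrite /=; lra.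
Qed.

End cylinders.

(** * The step volume as a sum of indicators *)

Section step_volume.
Context {R : realType} {d M : nat}.
Hypothesis M_gt0 : (0 < M)%N.
Variable cell : 'I_(M ^ d)%N -> d.-tuple 'I_M.
Hypothesis cell_bij : bijective cell.
Context {disp : measure_display} {T : measurableType disp} {P : probability T R}.
Variable Y : seq 'I_(M ^ d)%N -> {RV P >-> bool}.

Definition retained (s : seq 'I_(M ^ d)%N) : set T :=
  \bigcap_(u in [set` prefixes s]) Y u @^-1` [set true].

Lemma measurable_retained s : measurable (retained s).
Proof.
apply: fin_bigcap_measurable => // u _.
by rewrite -[X in measurable X]setTI; exact: measurable_funPT.
Qed.

Lemma retainedP s w : retained s w <->
  forall m, (1 <= m <= size s)%N -> Y (take m s) w = true.
Proof.
split=> [sw m m1s|sw _ /mapP[m + ->]]; last by rewrite mem_iota add1n ltnS => /sw.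
by apply: (sw (take m s)); apply: map_f; rewrite mem_iota add1n ltnS.
Qed.

(** For each outcome the retained words form a subfamily of one generation, and the volumes of any
    such subfamily add up. *)
Lemma step_volumeE n : step_volume cell Y n =
  fun w => \sum_(s : n.-tuple 'I_(M ^ d)) (M ^ d)%:R ^- n * \1_(retained s) w.
Proof.
apply/funext => w; rewrite /step_volume.
have -> : percolation_step cell Y n w = \bigcup_(s in
    [set` (fun s : n.-tuple 'I_(M ^ d) => `[< retained s w >])]) cylinder_cube cell s.
  (* Only n = 0 needs an argument: the sole word is empty, its condition is vacuous and its cylinder
     is the unit cube. *)
  have -> : percolation_step cell Y n w = \bigcup_(s in
      [set s : n.-tuple 'I_(M ^ d) | forall m, (1 <= m <= n)%N ->
        Y (take m s) w = true]) cylinder_cube cell s.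
    case: n => [|//]; apply/seteqP; split=> [x Jx|x [s _]].
      exists [tuple]; first by case.
      by exists x.
    by rewrite tuple0 => -[y Jy <-].
  apply: eq_bigcupl; split=> s /=.
    by move=> sw; apply/asboolP/retainedP; rewrite size_tuple.
  by move=> /asboolP/retainedP; rewrite size_tuple.
rewrite bigcup_pred volume_bigsetU_cylinder_cube//= big_mkcond.
apply: eq_bigr => s _; rewrite indicE; case: ifPn => [/asboolP|/asboolPn] sw.
  by rewrite mem_set ?mulr1.
by rewrite memNset ?mulr0.
Qed.

End step_volume.

(** * Mean and variance of the step volume *)

Theorem theorem3p1 (R : realType) (d M : nat) (p : R)
    (d1 : (1 <= d)%N) (M2 : (2 <= M)%N) (p0 : 0 < p) (p1 : p <= 1)
    (cell : 'I_(M ^ d)%N -> d.-tuple 'I_M) (cell_bij : bijective cell)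
    (disp : measure_display) (T : measurableType disp) (P : probability T R)
    (Y : seq 'I_(M ^ d)%N -> {RV P >-> bool})
    (Y_bernoulli : forall s, s != [::] ->
      distribution P (Y s) =1 bernoulli_prob p)
    (Y_indep : mutually_independent [set s | s != [::]] Y)
    (n : nat) :
  ('E_P[step_volume cell Y n] = (p ^+ n)%:E)%E /\
  ('V_P[step_volume cell Y n] =
    (if p != M%:R ^- d
     then (1 - p) / (M%:R ^+ d * p - 1) *
          (p ^+ (2 * n) - (p / M%:R ^+ d) ^+ n)
     else (1 - p) * n%:R * p ^+ (2 * n))%:E)%E.
Proof.
have M_gt0 : (0 < M)%N by exact: ltnW.
have p01 : 0 <= p <= 1 by rewrite ltW.
have N0 : #|'I_(M ^ d)|%:R != 0 :> R.
  by rewrite card_ord pnatr_eq0 -lt0n expn_gt0 M_gt0.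
have NE : M%:R ^+ d = #|'I_(M ^ d)|%:R :> R by rewrite card_ord natrX.
(* The assumptions on [Y] concern nonempty words only, so lists of indices must avoid [[::]]. *)
have nil_free D : [::] \notin D -> [set` D] `<=` [set s | s != [::]].
  by move=> D0 u /= uD; apply: contraNneq D0 => <-.
have P_retained s : P (retained Y s) = (p ^+ size s)%:E.
  rewrite (prob_all_true p01 Y_bernoulli Y_indep) ?undup_id ?uniq_prefixes//.
    by rewrite size_prefixes.
  exact/nil_free/nil_notin_prefixes.
have P_retainedI s t :
    P (retained Y s `&` retained Y t) = (p ^+ nb_joint_prefixes s t)%:E.
  (* Over the concatenated list a shared prefix appears twice, and [undup] in [prob_all_true] counts
     it once. *)
  have -> : retained Y s `&` retained Y t =
      \bigcap_(u in [set` prefixes s ++ prefixes t]) Y u @^-1` [set true].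
    rewrite -bigcap_setU; congr bigcap; apply/funext => u; apply/propext.
    by rewrite /= mem_cat; split=> /orP.
  rewrite (prob_all_true p01 Y_bernoulli Y_indep)//.
  by apply: nil_free; rewrite mem_cat negb_or !nil_notin_prefixes.
have mA (s : n.-tuple 'I_(M ^ d)) : measurable (retained Y s).
  exact: measurable_retained.
have mean : (\sum_(s : n.-tuple 'I_(M ^ d))
    ((M ^ d)%:R ^- n)%:E * P (retained Y s) = (p ^+ n)%:E)%E.
  under eq_bigr do rewrite P_retained -EFinM size_tuple.
  rewrite sumEFin sumr_const card_tuple -[X in X%:E]mulr_natl mulrA.
  by rewrite -[(M ^ d)%N in X in _ / X]card_ord natrX divff ?mul1r// expf_neq0.
rewrite step_volumeE// expectation_sum_indic// variance_sum_indic// mean.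
split=> //.
(* The second moment of the step volume is N^(-2n) times [joint_moment]. *)
have -> : (\sum_(s : n.-tuple 'I_(M ^ d)) \sum_(t : n.-tuple 'I_(M ^ d))
    ((M ^ d)%:R ^- n * (M ^ d)%:R ^- n)%:E * P (retained Y s `&` retained Y t))%E =
    (#|'I_(M ^ d)|%:R ^- n * #|'I_(M ^ d)|%:R ^- n *
      joint_moment (I := 'I_(M ^ d)) p n)%:E.
  rewrite /joint_moment mulr_sumr -sumEFin; apply: eq_bigr => s _.
  rewrite mulr_sumr -sumEFin; apply: eq_bigr => t _.
  by rewrite P_retainedI card_ord EFinM.
by rewrite -EFinM -EFinB joint_momentE// /volume_variance NE.
Qed.
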